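(* Let $y\in(0,\frac12)$, and let $k_n:=\kappa_n(y)$ for $n\ge 0$. If $$k_{n+1}\le 2k_n+\log_2k_n+\log_23-2$$ for each $n\ge0$, then $|L(y)|=2$. In particular, $|L(y)|=2$ if $k_{n+1}\le2k_n$ for each $n\ge 0$. On the other hand, if $$k_{n+1}\ge2k_n+\log_2k_n+\log_23$$ for some $n\ge0$, then $|L(y)|>2$.
   Context: Let $\phi(x)=\operatorname{dist}(x,\mathbb{Z})$; the Takagi function is $T(x)=\sum_{n=0}^\infty 2^{-n}\phi(2^nx)$, and $L(y)=\{x\in[0,1]:T(x)=y\}$. $|\cdot|$ denotes cardinality. Let $t_k=k/2^k$ for $k\in\mathbb{N}$, $I_2=[\frac12,\frac23]$, and $I_k=[t_k,t_{k-1})$ for $k\ge3$. Thus $[0,\frac23]$ is the disjoint union of $\{0\}$ and the $I_k$, $k\ge 2$. Define $\Psi:[0,\frac23]\to[0,\frac23]$ by $\Psi(0)=0$ and $\Psi(y)=4(y-t_k)$ if $y\in I_k$ ($k\ge 2$). $\Psi^n$ is the $n$-fold iterate, $\Psi^0(y)=y$. Define $\kappa:[0,\frac23]\to\{2,3,\dots,\infty\}$ by $\kappa(0)=\infty$ and $\kappa(y)=k$ if $y\in I_k$; and $\kappa_n(y)=\kappa(\Psi^n(y))$ for $n\ge0$. The usual conventions for $\infty$ apply (e.g. $\log_2\infty=\infty$, $2\cdot\infty=\infty$, $\infty\le\infty$). *)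

(* Defs.v *)
From mathcomp Require Import all_boot all_order all_algebra.
From mathcomp Require Import all_classical all_reals all_analysis.

Set Implicit Arguments.
Unset Strict Implicit.
Unset Printing Implicit Defensive.

Import Order.TTheory GRing.Theory Num.Theory.
Import numFieldNormedType.Exports.

Local Open Scope classical_set_scope.
Local Open Scope ring_scope.

Definition dist_int (R : realType) (x : R) : R :=
  inf [set `|x - m%:~R| | m in [set: int]].

Definition takagi (R : realType) (x : R) : R :=
  limn (series (fun n : nat => 2 ^- n * dist_int (2 ^+ n * x))).

Definition level_set (R : realType) (y : R) : set R :=
  [set x | 0 <= x <= 1 /\ takagi x = y].

Definition tpt (R : realType) (k : nat) : R := k%:R / 2 ^+ k.

(* Only meant for 2 <= k. *)
Definition Iset (R : realType) (k : nat) : set R :=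
  if k == 2 then [set y | 2^-1 <= y <= 2 / 3]
  else [set y | tpt R k <= y < tpt R k.-1].

(* For 0 < y <= 2/3 this is the only k >= 2 such that y lies in [Iset k];
   the default value 0 is used only if y lies in none of these intervals. *)
Definition Iindex (R : realType) (y : R) : nat :=
  xget 0%N [set k | (2 <= k)%N /\ Iset k y].

(* [Psi] and [kappa] are total functions on R; only their values on [0, 2/3],
   which [Psi] maps to itself, are meaningful. *)
Definition Psi (R : realType) (y : R) : R :=
  if y == 0 then 0 else 4 * (y - tpt R (Iindex y)).

Definition kappa (R : realType) (y : R) : \bar R :=
  if y == 0 then +oo%E else ((Iindex y)%:R)%:E.

Definition kappa_n (R : realType) (n : nat) (y : R) : \bar R :=
  kappa (iter n (@Psi R) y).

(* [lne +oo = +oo], hence [log2e +oo = +oo]. *)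
Definition log2e (R : realType) (x : \bar R) : \bar R :=
  (lne x * ((ln 2)^-1)%:E)%E.

Definition card_lt (T U : Type) (A : set T) (B : set U) : Prop :=
  (A #<= B)%card /\ (A #!= B)%card.

(* Main.v *)
(* By the symmetry T(1 - x) = T(x), count the solutions of T(x) = y in [0, 1/2].
   Let y lie in I_k, k >= 3, so that y = t_k + Psi(y) / 4. Since T >= t_(k-1) on
   [2^-(k-1), 1/2], there is no solution to the right of 2^-(k-1), and
   T(2^-k + x / 4) = t_k + T(x) / 4 puts the solutions in [2^-k, 2^-(k-1)] in
   bijection with the solutions for Psi(y). To the left of 2^-k one has
   T(2^-k (1 - v)) = t_k + 2^-k (T(v) - k v), where T(v) - k v has maximum
   (2 / 3) 2^-k; so excess solutions exist iff Psi(y) <= (8 / 3) 4^-k. Without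
   excess solutions at any stage two solutions are at distance at most 4^-n for
   all n; an excess solution at some stage lifts to a second solution for y.
   Comparing t_l <= Psi(y) < t_(l-1) with (8 / 3) 4^-k gives the thresholds. *)
Require Import Defs.
From mathcomp Require Import all_boot all_order all_algebra.
From mathcomp Require Import all_classical all_reals all_analysis.
From mathcomp Require Import ring lra zify.
Set Implicit Arguments.
Unset Strict Implicit.
Import Order.TTheory GRing.Theory Num.Theory.
Import numFieldNormedType.Exports.

Local Open Scope classical_set_scope.
Local Open Scope ring_scope.

Section Takagi.
Context {R : realType}.
Implicit Types (x y u v w z : R) (k l m n : nat).

Notation T := (@takagi R).

(** * Distance to the nearest integer *)

Lemma dist_int_le x (m : int) : dist_int x <= `|x - m%:~R|.
Proof.
apply: ge_inf; last by exists m.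
by exists 0 => _ [p _ <-].
Qed.

Lemma le_dist_int x z : (forall m : int, z <= `|x - m%:~R|) -> z <= dist_int x.
Proof.
move=> zle; apply: lb_le_inf; first by exists `|x - 0%:~R|, 0.
by move=> _ [p _ <-].
Qed.

Lemma dist_int_ge0 x : 0 <= dist_int x.
Proof. by apply: le_dist_int => m. Qed.

Lemma dist_int_le_half x : dist_int x <= 2^-1.
Proof.
have /andP[fx xf] := floor_itv x; rewrite intrD in xf.
have := dist_int_le x (Num.floor x); have := dist_int_le x (Num.floor x + 1).
rewrite intrD ltr0_norm ?subr_lt0// ger0_norm ?subr_ge0//; lra.
Qed.

Lemma dist_int_lipschitz x y : `|dist_int x - dist_int y| <= `|x - y|.
Proof.
suff H u v : dist_int u - `|u - v| <= dist_int v.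
  rewrite ler_norml; have := H x y; have := H y x; rewrite (distrC y); lra.
apply: le_dist_int => m; have := dist_int_le u m.
have := ler_distD v u m%:~R; lra.
Qed.

Lemma dist_intN x : dist_int (- x) = dist_int x.
Proof.
suff H u : dist_int (- u) <= dist_int u.
  by apply/le_anti; rewrite H -{1}(opprK x) H.
apply: le_dist_int => m; have := dist_int_le (- u) (- m).
by rewrite intrN -opprD normrN.
Qed.

Lemma dist_intDz x (m : int) : dist_int (x + m%:~R) = dist_int x.
Proof.
suff H u (p : int) : dist_int (u + p%:~R) <= dist_int u.
  apply/le_anti; rewrite H/=.
  by have := H (x + m%:~R) (- m); rewrite intrN addrK.
apply: le_dist_int => q; have := dist_int_le (u + p%:~R) (q + p).
by rewrite intrD opprD addrACA subrr addr0.
Qed.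

Lemma dist_int_id x : 0 <= x <= 2^-1 -> dist_int x = x.
Proof.
move=> /andP[x0 x1]; apply/le_anti/andP; split.
  by have := dist_int_le x 0; rewrite subr0 ger0_norm.
apply: le_dist_int => m; have [m0|m0] := leP m 0.
  have: m%:~R <= 0 :> R by rewrite lerz0.
  by have := ler_norm (x - m%:~R); lra.
have: 1 <= m%:~R :> R by rewrite ler1z; lia.
by have := ler_norm (m%:~R - x); rewrite distrC; lra.
Qed.

(** * Convergence, functional equation and symmetries of the Takagi series *)

Let term x n : R := 2 ^- n * dist_int (2 ^+ n * x).

Let term_ge0 x n : 0 <= term x n.
Proof. by rewrite mulr_ge0// dist_int_ge0. Qed.

Let partial_le x n : series (term x) n <= 1 - 2 ^- n.
Proof.
elim: n => [|n IH]; first by rewrite /series/= big_geq// expr0 invr1 subrr.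
have -> : series (term x) n.+1 = series (term x) n + term x n.
  by rewrite /series/= big_nat_recr.
have : term x n <= 2 ^- n * 2^-1.
  by rewrite ler_wpM2l// dist_int_le_half.
by rewrite exprS invfM; lra.
Qed.

Let partial_nd x : nondecreasing_seq (series (term x)).
Proof.
apply/nondecreasing_seqP => n.
by rewrite /series/= big_nat_recr//= lerDl term_ge0.
Qed.

Let partial_cvg x : cvgn (series (term x)).
Proof.
apply: nondecreasing_is_cvgn; first exact: partial_nd.
exists 1 => _ [n _ <-]; apply: le_trans (partial_le x n) _.
by rewrite gerBl.
Qed.

Lemma takagi_ge0 x : 0 <= T x.
Proof.
apply: limr_ge; first exact: partial_cvg.
by apply: nearW => n; apply: sumr_ge0 => i _; exact: term_ge0.
Qed.

Lemma takagi_le1 x : T x <= 1.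
Proof.
apply: limr_le; first exact: partial_cvg.
apply: nearW => n; apply: le_trans (partial_le x n) _.
by rewrite gerBl.
Qed.

(** Splitting off the term n = 0 turns the remaining terms at x into halves of the terms at 2 x;
    then pass to the limit. *)
Lemma takagi_rec x : T x = dist_int x + T (2 * x) / 2.
Proof.
have H : (fun n => series (term x) n.+1) =
  (fun n => dist_int x + series (term (2 * x)) n / 2).
  apply/funext => n; rewrite /series/= big_nat_recl//= /term expr0 mul1r invr1 mul1r.
  congr (_ + _); rewrite mulr_suml; apply: eq_bigr => i _.
  by rewrite exprSr invfM -(mulrA _ 2 x) mulrAC.
have c1 : series (term x) n.+1 @[n --> \oo] --> T x.
  by rewrite (cvg_shiftS (series (term x))); exact: partial_cvg.
have c2 : series (term x) n.+1 @[n --> \oo] --> dist_int x + T (2 * x) / 2.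
  by rewrite H; apply: cvgD; [exact: cvg_cst|apply: cvgMr_tmp; exact: partial_cvg].
exact: (cvg_unique (@norm_hausdorff _ _) c1 c2).
Qed.

Lemma takagiN x : T (- x) = T x.
Proof.
rewrite /takagi; congr (limn (series _)); apply/funext => n /=.
by rewrite (mulrN _ x) dist_intN.
Qed.

Lemma takagiDz x (m : int) : T (x + m%:~R) = T x.
Proof.
rewrite /takagi; congr (limn (series _)); apply/funext => n /=.
rewrite mulrDr -(dist_intDz (2 ^+ n * x) (2 ^+ n * m)).
by rewrite intrM rmorphXn/= .
Qed.

Lemma takagi_sym x : T (1 - x) = T x.
Proof. by rewrite -(takagiN x) addrC -(takagiDz (- x) 1). Qed.

Lemma takagi_half x : 0 <= x <= 2^-1 -> T x = x + T (2 * x) / 2.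
Proof. by move=> x01; rewrite {1}takagi_rec dist_int_id. Qed.

Lemma takagi0 : T 0 = 0.
Proof. by have := @takagi_half 0; rewrite mulr0; lra. Qed.

Lemma takagi1 : T 1 = 0.
Proof. by rewrite -takagi_sym subrr takagi0. Qed.

Lemma takagi_inv2 : T 2^-1 = 2^-1.
Proof. by rewrite takagi_half ?divff// ?takagi1; lra. Qed.

Lemma takagi_inv3 : T 3^-1 = 2 / 3.
Proof.
have := @takagi_half 3^-1; rewrite -(takagi_sym (2 * _)).
have -> : 1 - 2 * 3^-1 = 3^-1 :> R by lra.
lra.
Qed.

(** * Upper bound and continuity of T *)

Lemma takagi_le x : T x <= 2 / 3.
Proof.
(* phi(z) + phi(2z) / 2 <= 1 / 2, and 2 / 3 is the fixed point of
   c |-> 1 / 2 + c / 4. *)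
have step z c : (forall x, T x <= 2 / 3 + c) -> T z <= 2 / 3 + c / 4.
  move=> H.
  have {}H : T z <= dist_int z + dist_int (2 * z) / 2 + (2 / 3 + c) / 4.
    by rewrite (takagi_rec z) (takagi_rec (2 * z)); have := H (2 * (2 * z)); lra.
  suff : dist_int z + dist_int (2 * z) / 2 <= 2^-1 by lra.
  wlog zh : z {H} / 0 <= z <= 2^-1.
    move=> W; have /andP[fz zf] := floor_itv z; rewrite intrD in zf.
    have -> : z = (z - (Num.floor z)%:~R) + (Num.floor z)%:~R by rewrite subrK.
    have : 0 <= z - (Num.floor z)%:~R < 1 by lra.
    move: (z - _) => t t01.
    rewrite dist_intDz mulrDr.
    have -> : 2 * (Num.floor z)%:~R = (2 * Num.floor z)%:~R :> R by rewrite intrM.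
    rewrite dist_intDz; have [th|th] := leP t 2^-1.
      by apply: W; lra.
    have := W (1 - t).
    rewrite -(dist_intN (1 - t)) opprB -(dist_intN (2 * (1 - t))).
    have -> : - (2 * (1 - t)) = 2 * t + (- 2)%:~R by rewrite intrN; ring.
    have -> : t - 1 = t + (- 1)%:~R by rewrite intrN.
    by rewrite !dist_intDz; apply; lra.
  (* The sum equals 2 z up to 1/4 and is constantly 1/2 on [1/4, 1/2]. *)
  rewrite dist_int_id//; have [z4|z4] := leP z 4^-1.
    by rewrite dist_int_id; lra.
  have -> : 2 * z = - (1 - 2 * z) + 1%:~R by lra.
  by rewrite dist_intDz dist_intN dist_int_id; lra.
(* Starting from T <= 1, each use of [step] divides the excess over 2/3 by 4. *)
have H n z : T z <= 2 / 3 + 4 ^- n.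
  elim: n z => [|n IH] z; first by rewrite expr0 invr1; have := takagi_le1 z; lra.
  by rewrite exprSr invfM; exact: step.
apply/ler_addgt0Pr => e e0.
near \oo => n; apply: le_trans (H n x) _; rewrite lerD2l -exprVn.
near: n; have := @cvg_expr R 4^-1 ltac:(by rewrite ger0_norm; lra).
by move=> /cvgr0Pnorm_le /(_ _ e0); apply: filterS => n; rewrite ger0_norm.
Unshelve. all: end_near. Qed.

Lemma continuous_takagi : continuous T.
Proof.
(* The first n terms are 1-Lipschitz each, and the rest of the series takes values in [0, 2^-n]. *)
have H n u v : `|T u - T v| <= n%:R * `|u - v| + 2 ^- n.
  elim: n u v => [|n IH] u v.
    rewrite expr0 invr1 mul0r add0r ler_norml.
    have := takagi_le1 u; have := takagi_le1 v.
    have := takagi_ge0 u; have := takagi_ge0 v; lra.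
  rewrite (takagi_rec u) (takagi_rec v).
  have -> : dist_int u + T (2 * u) / 2 - (dist_int v + T (2 * v) / 2) =
    (dist_int u - dist_int v) + (T (2 * u) - T (2 * v)) / 2 by lra.
  apply: le_trans (ler_normD _ _) _.
  rewrite normrM (@ger0_norm _ 2^-1)//.
  have := dist_int_lipschitz u v; have := IH (2 * u) (2 * v).
  rewrite -mulrBr normrM (@ger0_norm _ 2)// exprS invfM -(natr1 n); lra.
move=> x; apply/cvgrPdist_le => e e0.
near \oo => n.
have ne : 2 ^- n <= e / 2.
  rewrite -exprVn; near: n.
  have := @cvg_expr R 2^-1 ltac:(by rewrite ger0_norm; lra).
  move=> /cvgr0Pnorm_le /(_ _ (divr_gt0 e0 (ltr0n _ 2))).
  by apply: filterS => n; rewrite ger0_norm.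
have d0 : 0 < e / 2 / n.+1%:R by rewrite !divr_gt0.
near=> t; apply: le_trans (H n x t) _.
have : `|x - t| <= e / 2 / n.+1%:R.
  by near: t; apply: cvgr_dist_le d0; exact: cvg_id.
rewrite ler_pdivlMr// -(natr1 n).
have := normr_ge0 (x - t); have : 0 <= n%:R :> R by []; nra.
Unshelve. all: end_near. Qed.

Lemma takagi_IVT a b y : a <= b -> Num.min (T a) (T b) <= y <= Num.max (T a) (T b) ->
  exists2 c, a <= c <= b & T c = y.
Proof.
move=> ab Hy; have [|c cab Tc] := IVT ab _ Hy.
  by apply: continuous_subspaceT; exact: continuous_takagi.
by exists c => //; rewrite in_itv/= in cab.
Qed.

(** * The sequence t_k *)

Notation t := (tpt R).

Lemma tptS k : t k.+1 = (t k + 2 ^- k) / 2.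
Proof. by rewrite /tpt -natr1 exprS invfM; lra. Qed.

Lemma tpt1 : t 1 = 2^-1.
Proof. by rewrite /tpt expr1; lra. Qed.

Lemma tptS_ge k : 2 ^- k <= 2 * t k.+1.
Proof. by rewrite tptS; have : 0 <= t k by [rewrite divr_ge0]; lra. Qed.

(** Monotonicity starts at index 1 only, since t_0 = 0 while t_1 = t_2 = 1/2. *)
Lemma tptSS_le k : t k.+2 <= t k.+1.
Proof. by rewrite tptS; have := tptS_ge k; rewrite exprS invfM; lra. Qed.

Lemma tptS_le_half k : t k.+1 <= 2^-1.
Proof. by elim: k => [|k IH]; [rewrite tpt1|apply: le_trans (tptSS_le k) IH]. Qed.

Lemma exprVn2_gt0 k : 0 < 2 ^- k :> R.
Proof. by rewrite invr_gt0 exprn_gt0. Qed.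

Lemma exprVn2_le1 k : 2 ^- k <= 1 :> R.
Proof. by rewrite invf_le1 ?exprn_gt0// exprn_ege1// ler1n. Qed.

(** * Self-similarity of T around the points 2^-k *)

(** Each of the k halvings goes through [takagi_half] and contributes the same linear term 2^-k
    x. *)
Lemma takagi_scale k x : 0 <= x <= 1 -> T (2 ^- k * x) = 2 ^- k * (T x + k%:R * x).
Proof.
move=> x01; elim: k => [|k IH]; first by rewrite expr0 invr1 !mul1r mul0r addr0.
have := exprVn2_gt0 k; have := exprVn2_le1 k => pk1 pk0.
rewrite takagi_half; last by rewrite exprS invfM; nra.
have -> : 2 * (2 ^- k.+1 * x) = 2 ^- k * x by rewrite exprS invfM; lra.
by rewrite IH exprS invfM -(natr1 k); lra.
Qed.

Lemma takagi_ge_tpt k x : 2 ^- k.+1 <= x <= 2^-1 -> t k.+1 <= T x.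
Proof.
elim: k x => [|k IH] x xk.
  have -> : x = 2^-1 by move: xk; rewrite expr1; lra.
  by rewrite takagi_inv2 tpt1.
have := exprVn2_gt0 k.+2 => p0.
rewrite takagi_half; last by lra.
have [x4|x4] := leP (2 * x) 2^-1.
  have := IH (2 * x); move: xk; rewrite (tptS k.+1) [2 ^+ k.+2]exprS invfM; lra.
(* For 1/4 < x <= 1/2, T(2 x) = T(1 - 2 x) >= 1 - 2 x, so that T(x) >= x + (1 - 2 x) / 2 = 1/2. *)
apply: le_trans (tptS_le_half k.+1) _.
rewrite -takagi_sym takagi_half; last by lra.
by have := takagi_ge0 (2 * (1 - 2 * x)); lra.
Qed.

Lemma takagi_left k v : 0 <= v <= 1 ->
  T (2 ^- k * (1 - v)) = t k + 2 ^- k * (T v - k%:R * v).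
Proof.
by move=> v01; rewrite takagi_scale ?takagi_sym ?/tpt; lra.
Qed.

(** For v <= 1/2, doubling v lowers the slope by one and halves the value. For v > 1/2 the linear
    term is large enough against T <= 2/3. By [takagi_scale] the bound is attained at v = 2^-k /
    3. *)
Lemma takagi_slope k v : 0 <= v <= 1 -> T v - k%:R * v <= 2 / 3 * 2 ^- k.
Proof.
elim: k v => [|k IH] v v01.
  by rewrite expr0 invr1 mul0r; have := takagi_le v; lra.
rewrite exprS invfM -(natr1 k); have [v2|v2] := leP v 2^-1.
  by rewrite takagi_half; [have := IH (2 * v)|]; lra.
have := takagi_le v; have := exprVn2_gt0 k; case: k {IH} => [|k].
  by rewrite expr0 invr1; lra.
have : 1 * v <= k.+1%:R * v by rewrite ler_wpM2r ?ler1n//; lra.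
lra.
Qed.

(** Over [2^-(k+2), 2^-(k+1)] the graph is a copy of the graph over [0, 2^-k], scaled by 1/4. Around
    1/4 two uses of the functional equation, one of them after a reflection, have cancelling slopes;
    halving the argument carries this to larger k. *)
Lemma takagi_right k x : 0 <= x <= 2 ^- k ->
  T (2 ^- k.+2 + x / 4) = t k.+2 + T x / 4.
Proof.
elim: k x => [|k IH] x xk.
  move: xk; rewrite expr0 invr1 tptS tpt1 expr1 => xk.
  have -> : 2 ^- 2 = 4^-1 :> R by rewrite -natrX.
  rewrite takagi_half; last lra.
  rewrite -(takagi_sym (2 * _)) takagi_half; last lra.
  have -> : 2 * (1 - 2 * (4^-1 + x / 4)) = 1 - x by lra.
  rewrite takagi_sym; lra.
have := exprVn2_gt0 k; have := exprVn2_le1 k => pk1 pk0.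
move: xk; rewrite tptS !exprS !invfM => xk.
rewrite takagi_half; last lra.
have -> : 2 * (2^-1 * (2^-1 * (2^-1 * 2 ^- k)) + x / 4) = 2 ^- k.+2 + (2 * x) / 4.
  by rewrite !exprS !invfM; lra.
rewrite IH; last lra.
rewrite (takagi_half (x:=x)); lra.
Qed.

(** * Solutions in [0, 1/2] and the map Psi *)

Lemma half_solution_exists y : 0 <= y < 2^-1 -> exists2 x, 0 <= x <= 2^-1 & T x = y.
Proof.
move=> y01; apply: takagi_IVT => //.
by rewrite takagi0 takagi_inv2 min_l ?max_r//; lra.
Qed.

(* As T(2^-k) = t_k, a solution [x > 0] of T(x) = y forces t_k <= y as soon as
   2^-k <= x. *)
Lemma Iset_exists y : 0 < y < 2^-1 -> exists k, (2 <= k)%N /\ Iset k y.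
Proof.
move=> y01; have [|x x01 Tx] := @half_solution_exists y; first lra.
have x0 : 0 < x.
  rewrite lt_neqAle eq_sym; apply/andP; split; last lra.
  by apply: contraPneq Tx => ->; rewrite takagi0; lra.
(* The minimum is sought over k + 1, as t_0 = 0 would always qualify; t_1 and t_2 exceed y. *)
have exk : exists k, t k.+1 <= y.
  exists (Num.bound x^-1); rewrite -Tx; apply: takagi_ge_tpt.
  apply/andP; split; last lra.
  rewrite invf_ple ?posrE ?exprn_gt0//.
  have := archi_boundP (ltW (_ : 0 < x^-1)); rewrite invr_gt0 => /(_ x0) xb.
  apply: le_trans (ltW xb) _; rewrite -natrX ler_nat.
  by rewrite (leq_trans (leqnSn _))// ltnW// ltn_expl.
case: (ex_minnP exk) => -[|[|k]]; [rewrite tpt1; lra|rewrite tptS tpt1 expr1; lra|].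
move=> tk /(_ k.+1) kmin; exists k.+3; split=> //; rewrite /Iset/= tk/=.
by rewrite ltNge; apply/negP => /kmin; rewrite ltnn.
Qed.

(** The bound y < 1/2 rules out I_2, so the index is some K >= 3; the bound on Psi(y) is 4 (t_(K-1)
    - t_K) = t_(K-2). *)
Lemma Psi_spec y : 0 < y < 2^-1 -> exists k,
  [/\ Iindex y = k.+3, t k.+3 <= y < t k.+2, y = t k.+3 + Psi y / 4
    & 0 <= Psi y < t k.+1].
Proof.
move=> y01; have [] := xgetPex 0%N (Iset_exists y01).
rewrite -/(Iindex y); rewrite /Psi; have /gt_eqF -> : 0 < y by lra.
case: (Iindex y) => [|[|[|k]]]//; first by rewrite /Iset eqxx/=; lra.
rewrite /Iset/= => _ tky; exists k; split=> //; first lra.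
by move: tky; rewrite !(tptS k.+2, tptS k.+1) !exprS !invfM; lra.
Qed.

Lemma Psi_ge0_lt_half y : 0 <= y < 2^-1 -> 0 <= Psi y < 2^-1.
Proof.
move=> y01; have [->|y0] := eqVneq y 0; first by rewrite /Psi eqxx; lra.
have [|k [_ _ _]] := @Psi_spec y; first by rewrite lt_neqAle eq_sym y0; lra.
by have := tptS_le_half k; lra.
Qed.

(** * Lifted and excess solutions, and descent to Psi(y) *)

Lemma lift_solution y x : 0 < y < 2^-1 -> 0 <= x <= 2^-1 -> T x = Psi y ->
  let x' := 2 ^- Iindex y + x / 4 in
  [/\ 2 ^- Iindex y <= x', x' <= 2^-1 & T x' = y].
Proof.
move=> y01 x01 Tx; have [k [-> _ yE Py]] := Psi_spec y01.
(* Further right, up to 1/2, T is at least t_(k+1) > Psi(y). *)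
have xk : x <= 2 ^- k.+1.
  by rewrite leNgt; apply/negP => xk; have := @takagi_ge_tpt k x; lra.
split; first lra.
  by move: xk; rewrite !exprS !invfM; have := exprVn2_le1 k; lra.
by rewrite takagi_right ?Tx; lra.
Qed.

Lemma excess_solution y : 0 < y < 2^-1 -> Psi y <= 8 / 3 * 4 ^- Iindex y ->
  exists2 x, 0 <= x < 2 ^- Iindex y & T x = y.
Proof.
move=> y01; have [k [-> _ yE Py]] := Psi_spec y01; set K := k.+3 => PK.
have e4 : 4 ^+ K = 2 ^+ K * 2 ^+ K :> R by rewrite -exprMn; congr (_ ^+ _); lra.
have p0 := exprVn2_gt0 K; have p1 := exprVn2_le1 K.
have K0 : 2 ^+ K != 0 :> R by rewrite expf_neq0.
(* With v = 2^-K w, T(2^-K (1 - v)) = t_K + 4^-K T(w), so T(w) must be 4^K Psi(y) / 4, which is at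
   most 2/3. On [1/3, 1], T passes from 2/3 to 0, and w > 0 puts the solution strictly left of
   2^-K. *)
have [||w w01 Tw] := takagi_IVT (a:=3^-1) (b:=1) (y:=4 ^+ K * Psi y / 4); first lra.
  have K4 : 0 < 4 ^+ K :> R by rewrite exprn_gt0.
  move: PK; rewrite ler_pdivlMr// => PK.
  rewrite takagi_inv3 takagi1 min_r ?max_l; nra.
have w2 : 0 <= 2 ^- K * w <= 1 by nra.
exists (2 ^- K * (1 - 2 ^- K * w)); first by nra.
rewrite takagi_left// takagi_scale ?Tw; last lra.
by rewrite e4 [RHS]yE; field.
Qed.

Lemma descend_solution y x : 0 < y < 2^-1 -> 8 / 3 * 4 ^- Iindex y < Psi y ->
  0 <= x <= 2^-1 -> T x = y ->
  exists x', [/\ 0 <= x' <= 2^-1, T x' = Psi y & x = 2 ^- Iindex y + x' / 4].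
Proof.
move=> y01; have [k [-> yk yE Py]] := Psi_spec y01 => PK x01 Tx.
have p0 := exprVn2_gt0 k.+3; have p1 := exprVn2_le1 k.
have xge : 2 ^- k.+3 <= x.
  rewrite leNgt; apply/negP => xk.
  (* With v = 1 - 2^(k+3) x, [takagi_slope] yields y <= t_(k+3) + (2 / 3) 4^-(k+3), against the
     lower bound on Psi(y). *)
  have v01 : 0 <= 1 - 2 ^+ k.+3 * x <= 1.
    have : 0 <= 2 ^+ k.+3 * x by rewrite mulr_ge0// ?exprn_ge0//; lra.
    have : 2 ^+ k.+3 * x < 1 by rewrite mulrC -ltr_pdivlMr ?exprn_gt0// div1r.
    lra.
  have := takagi_left k.+3 v01; rewrite opprB addrC subrK mulKf ?expf_neq0//.
  have := takagi_slope k.+3 v01; rewrite Tx.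
  have e4 : 4 ^- k.+3 = 2 ^- k.+3 * 2 ^- k.+3 :> R.
    by rewrite -invfM -exprMn; congr (_ ^- _); lra.
  rewrite e4 in PK; nra.
have xle : x < 2 ^- k.+2.
  by rewrite ltNge; apply/negP => xk; have := @takagi_ge_tpt k.+1 x; lra.
exists (4 * (x - 2 ^- k.+3)).
have xE : x = 2 ^- k.+3 + 4 * (x - 2 ^- k.+3) / 4 by lra.
move: xle (xge); rewrite !exprS !invfM => xle xge'.
split; [lra| |lra].
have := @takagi_right k.+1 (4 * (x - 2 ^- k.+3)); rewrite -xE Tx.
by rewrite !exprS !invfM; lra.
Qed.

(** * Several solutions or a single one in [0, 1/2] *)

Definition two_half_solutions y := exists x1 x2,
  [/\ 0 <= x1 <= 2^-1, 0 <= x2 <= 2^-1, T x1 = y, T x2 = y & x1 < x2].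

(** The excess solution lies strictly left of 2^-k, the lift of a solution for Psi(y) does not. *)
Lemma two_half_solutions_excess y : 0 < y < 2^-1 ->
  Psi y <= 8 / 3 * 4 ^- Iindex y -> two_half_solutions y.
Proof.
move=> y01 /(excess_solution y01)[x1 x101 Tx1].
have [|x x01 Tx] := half_solution_exists (y:=Psi y).
  by apply: Psi_ge0_lt_half; lra.
have [x2k x2h Tx2] := lift_solution y01 x01 Tx.
exists x1, (2 ^- Iindex y + x / 4); move: (2 ^- Iindex y) x2k x2h Tx2 x101 => p *.
by split; [lra|lra|by []|by []|lra].
Qed.

Lemma two_half_solutions_Psi y : 0 <= y < 2^-1 ->
  two_half_solutions (Psi y) -> two_half_solutions y.
Proof.
move=> y01; have [->|y0] := eqVneq y 0; first by rewrite /Psi eqxx.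
have {}y01 : 0 < y < 2^-1 by rewrite lt_neqAle eq_sym y0.
move=> [x1 [x2 [x101 x201 Tx1 Tx2 x12]]].
have [k1 h1 T1] := lift_solution y01 x101 Tx1.
have [k2 h2 T2] := lift_solution y01 x201 Tx2.
have p0 := exprVn2_gt0 (Iindex y).
exists (2 ^- Iindex y + x1 / 4), (2 ^- Iindex y + x2 / 4).
move: (2 ^- Iindex y) p0 k1 h1 T1 k2 h2 T2 => p *.
by split; [lra|lra|by []|by []|lra].
Qed.

Lemma iter_Psi_ge0_lt_half n y : 0 <= y < 2^-1 -> 0 <= iter n (@Psi R) y < 2^-1.
Proof. by move=> y01; elim: n => //= n; exact: Psi_ge0_lt_half. Qed.

Lemma two_half_solutions_iter n y : 0 <= y < 2^-1 ->
  two_half_solutions (iter n (@Psi R) y) -> two_half_solutions y.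
Proof.
move=> y01; elim: n => //= n IH two; apply/IH/two_half_solutions_Psi => //.
exact: iter_Psi_ge0_lt_half.
Qed.

(** [descend_solution] writes both solutions as the same point plus a quarter of a solution for
    Psi(y), so each stage divides the distance by 4. *)
Lemma half_solution_unique y x1 x2 : y < 2^-1 ->
  (forall n, let z := iter n (@Psi R) y in
    0 < z /\ 8 / 3 * 4 ^- Iindex z < Psi z) ->
  0 <= x1 <= 2^-1 -> 0 <= x2 <= 2^-1 -> T x1 = y -> T x2 = y -> x1 = x2.
Proof.
move=> y2 zP x101 x201 Tx1 Tx2.
have contr n : `|x1 - x2| <= 4 ^- n.
  elim: n y x1 x2 y2 zP x101 x201 Tx1 Tx2 => [|n IH] y x1 x2 y2 zP x101 x201 Tx1 Tx2.
    by rewrite expr0 invr1 ler_norml; lra.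
  have [/= y0 Py] := zP 0%N; have y01 : 0 < y < 2^-1 by rewrite y0.
  have [u1 [u101 Tu1 ->]] := descend_solution y01 Py x101 Tx1.
  have [u2 [u201 Tu2 ->]] := descend_solution y01 Py x201 Tx2.
  have -> : 2 ^- Iindex y + u1 / 4 - (2 ^- Iindex y + u2 / 4) = (u1 - u2) / 4.
    by rewrite opprD addrACA subrr add0r mulrBl.
  rewrite normrM (@ger0_norm _ 4^-1)// exprSr invfM ler_pM2r//.
  apply: (IH (Psi y)) => //; first by have := @Psi_ge0_lt_half y; lra.
  by move=> m; have := zP m.+1; rewrite iterSr.
apply/eqP; rewrite -subr_eq0 -normr_le0 leNgt; apply/negP => d0.
have := archi_boundP (ltW (_ : 0 < `|x1 - x2|^-1)).
rewrite invr_gt0 => /(_ d0); set n := Num.bound _ => xn.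
have := contr n; rewrite leNgt => /negP; apply.
rewrite invf_plt ?posrE ?exprn_gt0//; apply: lt_le_trans xn _.
by rewrite -natrX ler_nat ltnW// ltn_expl.
Qed.

(** * From solutions in [0, 1/2] to cardinalities *)

Lemma level_set_sym y x : level_set y x -> level_set y (1 - x).
Proof. by move=> [x01 Tx]; split; [lra|rewrite takagi_sym]. Qed.

Lemma level_set_card2 y : 0 <= y < 2^-1 ->
  (forall x1 x2, 0 <= x1 <= 2^-1 -> 0 <= x2 <= 2^-1 -> T x1 = y -> T x2 = y ->
    x1 = x2) ->
  (level_set y #= `I_2)%card.
Proof.
move=> y01 uniq; have [x x01 Tx] := half_solution_exists y01.
(* This makes x and 1 - x distinct. *)
have /eqP x2 : x != 2^-1 by apply: contraPneq Tx => ->; rewrite takagi_inv2; lra.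
have Lx : level_set y x by split=> //; lra.
pose f i := if i == 0%N then x else 1 - x.
have -> : level_set y = f @` `I_2.
  apply/seteqP; split=> [w [w01 Tw]|_ [i _ <-]]; last first.
    by rewrite /f; case: ifP => // _; exact: level_set_sym.
  have [w2|w2] := leP w 2^-1.
    by exists 0%N => //; rewrite /f/=; apply: uniq => //; lra.
  exists 1%N => //; rewrite /f/= (uniq x (1 - w))// ?takagi_sym//; lra.
apply: inj_card_eq => i j; rewrite !inE/= /f.
by case: i j => [|[|i]] [|[|j]]//= _ _ E; exfalso; lra.
Qed.

Lemma level_set_card_gt2 y : y < 2^-1 -> two_half_solutions y ->
  card_lt `I_2 (level_set y).
Proof.
move=> y2 [x1 [x2 [x101 x201 Tx1 Tx2 x12]]].
have /eqP x2h : x2 != 2^-1 by apply: contraPneq Tx2 => ->; rewrite takagi_inv2; lra.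
(* As x2 < 1/2, the three values increase: x1 < x2 < 1 - x2. *)
pose f i := if i == 0%N then x1 else if i == 1%N then x2 else 1 - x2.
have c3 : (`I_3 #<= level_set y)%card.
  have fI : (f @` `I_3 #= `I_3)%card.
    apply: inj_card_eq => i j; rewrite !inE/= /f.
    by case: i j => [|[|[|i]]] [|[|[|j]]]//= _ _ E; exfalso; lra.
  rewrite -(card_le_eql fI); apply: subset_card_le => _ [i _ <-].
  have L1 : level_set y x1 by split=> //; lra.
  have L2 : level_set y x2 by split=> //; lra.
  by rewrite /f; do 2!case: ifP => // _; exact: level_set_sym.
split; first by apply: card_le_trans c3; rewrite card_le_II.
by apply/negP => c2; move: c3; rewrite -(card_le_eqr c2) card_le_II.
Qed.

(** * Comparison of t_l with (8 / 3) 4^-k *)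

(** For l > 2 k the second alternative gives 8 2^l <= 6 k 4^k < 3 l 4^k. For l <= 2 k, t_l >= t_(2k)
    = 2 k / 4^k, and 6 k > 8. *)
Lemma lt_tpt k l : (3 <= k)%N -> (3 <= l)%N ->
  ((l <= 2 * k) || (2 ^ (l + 2) <= 3 * k * 4 ^ k))%N -> 8 / 3 * 4 ^- k < t l.
Proof.
move=> k3 l3 lk; suff : (8 * 2 ^ l < 3 * l * 4 ^ k)%N.
  rewrite -(ltr_nat R) !natrM !natrX => H.
  rewrite /tpt ltr_pdivlMr ?exprn_gt0// mulrAC ltr_pdivrMr ?exprn_gt0//; lra.
have H m : (l <= m -> 3 * m * 2 ^ l <= 3 * l * 2 ^ m)%N.
  elim: m => [|m IH]; first lia.
  rewrite leq_eqVlt => /predU1P[->//|lm]; have {}IH := IH lm.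
  have : (0 < 2 ^ l)%N by rewrite expn_gt0.
  rewrite expnS; nia.
have e4 : (4 ^ k = 2 ^ (2 * k))%N by rewrite expnM.
have := expn_gt0 2 l; have := expn_gt0 4 k => /= p4 p2.
have [l2|l2] := leqP l (2 * k); last by rewrite leqNgt l2/= expnD in lk; nia.
by have := H _ l2; rewrite -e4; nia.
Qed.

Lemma tpt_le k l : (3 <= k)%N -> (3 * k * 4 ^ k <= 2 ^ l.+1)%N ->
  t l <= 8 / 3 * 4 ^- k.
Proof.
move=> k3 kl; suff : (3 * l * 4 ^ k <= 8 * 2 ^ l)%N.
  rewrite -(ler_nat R) !natrM !natrX => H.
  rewrite /tpt ler_pdivrMr ?exprn_gt0// mulrAC ler_pdivlMr ?exprn_gt0//; lra.
(* For l <= 4 k, 3 l 4^k <= 12 k 4^k <= 8 2^l. Otherwise l < 2 (l - 2 k) and l - 2 k < 2^(l - 2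
   k). *)
have [lk|lk] := leqP l (4 * k).
  by rewrite expnS in kl; have := expn_gt0 4 k; nia.
have -> : (l = 2 * k + (l - 2 * k))%N by lia.
rewrite expnD expnM; have := expn_gt0 (2 ^ 2) k => /= p4.
have : (l - 2 * k < 2 ^ (l - 2 * k))%N by rewrite ltn_expl.
move: (2 ^ (l - 2 * k))%N (4 ^ k)%N p4 => a b; nia.
Qed.

(** * Logarithmic conditions as inequalities between natural numbers *)

Lemma ln2_gt0 : 0 < ln 2 :> R.
Proof. by rewrite ln_gt0 ?ltr1n. Qed.

Lemma log2e_natr k : (0 < k)%N -> log2e k%:R%:E = (ln k%:R / ln 2)%:E :> \bar R.
Proof. by move=> k0; rewrite /log2e lne_EFin ?ltr0n. Qed.

Lemma ln_3k4k k : (0 < k)%N ->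
  ln (3 * k * 4 ^ k)%:R = (2 * k%:R + ln k%:R / ln 2 + ln 3 / ln 2) * ln 2 :> R.
Proof.
move=> k0; have l2 : ln 2 != 0 :> R by rewrite gt_eqF ?ln2_gt0.
have -> : (4 ^ k = 2 ^ (2 * k))%N by rewrite expnM.
rewrite !natrM natrX !lnM ?posrE ?mulr_gt0 ?exprn_gt0 ?ltr0n// lnXn ?ltr0n//.
rewrite -(mulr_natl (ln 2)) natrM !(mulrDl _ _ (ln 2)) !divfK//.
by rewrite addrC [ln 3 + _]addrC addrA.
Qed.

(** Exponentiate to base 2; the summand -2 becomes the 2 in the exponent l + 2. *)
Lemma log2e_bound_le k l : (0 < k)%N ->
  (l%:R%:E <= 2%:E * k%:R%:E + log2e k%:R%:E + log2e 3%:E - 2%:E :> \bar R)%E ->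
  (2 ^ (l + 2) <= 3 * k * 4 ^ k)%N.
Proof.
move=> k0; rewrite log2e_natr// (log2e_natr (k:=3))// lee_fin => H.
rewrite -(ler_nat R) -ler_ln ?posrE ?ltr0n ?muln_gt0 ?expn_gt0 ?k0//.
rewrite ln_3k4k// natrX lnXn// -(mulr_natl (ln 2)) ler_pM2r ?ln2_gt0// natrD; lra.
Qed.

Lemma log2e_bound_ge k l : (0 < k)%N ->
  (2%:E * k%:R%:E + log2e k%:R%:E + log2e 3%:E <= l%:R%:E :> \bar R)%E ->
  (3 * k * 4 ^ k <= 2 ^ l)%N.
Proof.
move=> k0; rewrite log2e_natr// (log2e_natr (k:=3))// lee_fin => H.
rewrite -(ler_nat R) -ler_ln ?posrE ?ltr0n ?muln_gt0 ?expn_gt0 ?k0//.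
by rewrite ln_3k4k// natrX lnXn// -(mulr_natl (ln 2)) ler_pM2r ?ln2_gt0.
Qed.

(** * The criteria in terms of consecutive indices *)

Lemma kappa_fin y : y != 0 -> kappa y = (Iindex y)%:R%:E.
Proof. by move=> /negPf y0; rewrite /kappa y0. Qed.

Lemma excess_lt_Psi y : 0 < y < 2^-1 -> Psi y != 0 ->
  let k := Iindex y in let l := Iindex (Psi y) in
  ((l <= 2 * k) || (2 ^ (l + 2) <= 3 * k * 4 ^ k))%N ->
  8 / 3 * 4 ^- Iindex y < Psi y.
Proof.
move=> y01 Py0 k l kl; have Py : 0 < Psi y < 2^-1.
  by rewrite lt_neqAle eq_sym Py0; apply: Psi_ge0_lt_half; lra.
have [p [lE /andP[tl _] _ _]] := Psi_spec Py; have [q [kE _ _ _]] := Psi_spec y01.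
rewrite -lE in tl; apply: lt_le_trans tl.
by apply: lt_tpt => //; rewrite ?kE ?lE.
Qed.

Lemma Psi_le_excess y : 0 < y < 2^-1 ->
  let k := Iindex y in let l := Iindex (Psi y) in
  (Psi y != 0 -> (3 * k * 4 ^ k <= 2 ^ l)%N) -> Psi y <= 8 / 3 * 4 ^- Iindex y.
Proof.
move=> y01 k l; rewrite {}/k {}/l; have [->|Py0] := eqVneq (Psi y) 0.
  by move=> _; rewrite mulr_ge0// invr_ge0 exprn_ge0.
have Py : 0 < Psi y < 2^-1.
  by rewrite lt_neqAle eq_sym Py0; apply: Psi_ge0_lt_half; lra.
have [p [-> /andP[_ /ltW tl] _ _]] := Psi_spec Py; have [q [-> _ _ _]] := Psi_spec y01.
(* As Psi(y) < t_(l-1), [tpt_le] is applied at l - 1, where its hypothesis reads 3 k 4^k <= 2^l. *)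
by move=> /(_ isT) kl; apply: le_trans tl _; apply: tpt_le.
Qed.

Lemma level_set_card2_kappa y : 0 < y < 2^-1 ->
  (forall n, let z := iter n (@Psi R) y in 0 < z < 2^-1 ->
    let k := Iindex z in let l := Iindex (Psi z) in
    Psi z != 0 /\ ((l <= 2 * k) || (2 ^ (l + 2) <= 3 * k * 4 ^ k))%N) ->
  (level_set y #= `I_2)%card.
Proof.
(* The condition at each stage includes Psi(z) != 0, which keeps the orbit positive. *)
move=> y01 H; have z01 n : 0 < iter n (@Psi R) y < 2^-1.
  elim: n => //= n IH; have [Pz _] := H n IH.
  by rewrite lt_neqAle eq_sym Pz; apply: Psi_ge0_lt_half; lra.
apply: level_set_card2; first lra.
move=> x1 x2; apply: half_solution_unique; first lra.
move=> n z; have [Pz kl] := H n (z01 n); split; first by case/andP: (z01 n).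
exact: excess_lt_Psi (z01 n) Pz kl.
Qed.

Lemma level_set_card_gt2_kappa y n : 0 < y < 2^-1 ->
  let z := iter n (@Psi R) y in 0 < z < 2^-1 ->
  let k := Iindex z in let l := Iindex (Psi z) in
  (Psi z != 0 -> (3 * k * 4 ^ k <= 2 ^ l)%N) ->
  card_lt `I_2 (level_set y).
Proof.
move=> y01 z z01 k l kl; apply: level_set_card_gt2; first lra.
apply: (@two_half_solutions_iter n); first lra.
exact/two_half_solutions_excess/Psi_le_excess.
Qed.

End Takagi.

Theorem corollary4p3 (R : realType) (y : R) (hy : 0 < y < 2^-1) :
  let k := fun n : nat => kappa_n n y in
  [/\ (forall n : nat,
         (k n.+1 <= 2%:E * k n + log2e (k n) + log2e 3%:E - 2%:E)%E) ->
      (level_set y #= `I_2)%card,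
      (forall n : nat, (k n.+1 <= 2%:E * k n)%E) ->
      (level_set y #= `I_2)%card
    & (exists n : nat,
         (2%:E * k n + log2e (k n) + log2e 3%:E <= k n.+1)%E) ->
      card_lt `I_2 (level_set y)].
Proof.
have Iindex_gt0 (z : R) : 0 < z < 2^-1 -> (0 < Iindex z)%N.
  by move=> /Psi_spec[p [-> _ _ _]].
move=> k; rewrite {}/k /kappa_n; split.
- move=> H; apply: level_set_card2_kappa => // n z z01; have := H n.
  have z0 : z != 0 by lra.
  rewrite iterS -/z (kappa_fin z0); have [->|Pz0] := eqVneq (Psi z) 0.
    (* If Psi(z) = 0, the hypothesis would bound +oo by a finite number. *)
    by rewrite /kappa eqxx log2e_natr ?Iindex_gt0// (log2e_natr (k:=3)).
  rewrite (kappa_fin Pz0) => kl; split=> //; apply/orP; right.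
  exact: log2e_bound_le (Iindex_gt0 _ z01) kl.
- move=> H; apply: level_set_card2_kappa => // n z z01; have := H n.
  have z0 : z != 0 by lra.
  rewrite iterS -/z (kappa_fin z0); have [->|Pz0] := eqVneq (Psi z) 0.
    by rewrite /kappa eqxx.
  rewrite (kappa_fin Pz0) lee_fin -natrM ler_nat => kl.
  by split=> //; rewrite kl.
move=> [n]; have zge0 m := iter_Psi_ge0_lt_half m (y:=y).
have [z0|z0] := eqVneq (iter n (@Psi R) y) 0.
  (* [k n = +oo] makes the hypothesis void; the excess solution then comes from
     the stage [m] just before the orbit first hits 0. *)
  move=> _; have exz : exists m, iter m (@Psi R) y == 0 by exists n; apply/eqP.
  case: (ex_minnP exz) => -[|m] /eqP mz mmin; first by move: mz => /=; lra.
  apply: (@level_set_card_gt2_kappa R y m) => //; last first.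
    by rewrite -iterS mz eqxx.
  rewrite lt_neqAle eq_sym; have -> : iter m (@Psi R) y != 0.
    by apply/negP => /mmin; rewrite ltnn.
  by apply: zge0; lra.
have z01 : 0 < iter n (@Psi R) y < 2^-1.
  by rewrite lt_neqAle eq_sym z0; apply: zge0; lra.
rewrite iterS (kappa_fin z0) => kl; apply: (level_set_card_gt2_kappa hy z01).
move=> Pz0; rewrite (kappa_fin Pz0) in kl.
exact: log2e_bound_ge (Iindex_gt0 _ z01) kl.
Qed.
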